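(* Let $V_T$ be an (affine or projective) simplicial toric variety of codimension $2$, attached to a fixed finite set $T$ of exponent vectors (the base field $K$ is allowed to vary). Then $V_T$ is a binomial set-theoretic complete intersection in characteristic $p$ either (a) for exactly one prime $p$, or (b) for every prime $p$, or (c) for no prime $p$.
   Context: Let $K$ be an algebraically closed field and let $T=\{\mathbf t_1,\dots,\mathbf t_m\}$ be a set of $m$ distinct vectors $\mathbf t_i=(t_{i1},\dots,t_{in})$ with nonnegative integer entries, $n\ge 1$. Let $\phi_T:K[z_1,\dots,z_m]\to K[u_1,\dots,u_n]$ be the $K$-algebra homomorphism with $\phi_T(z_i)=u_1^{t_{i1}}\cdots u_n^{t_{in}}$, and let $I_T=\ker\phi_T$. The affine toric variety $V_T\subset K^m$ is the zero set of $I_T$; it is the variety parametrized by $z_i=u_1^{t_{i1}}\cdots u_n^{t_{in}}$ ($1\le i\le m$). If all the sums $\sum_{j=1}^n t_{ij}$ ($1\le i\le m$) are equal, the parametrization is called homogeneous, $I_T$ is a homogeneous ideal and it also defines a projective toric variety $V_T\subset\mathbb P^{m-1}$. The dimension of $V_T$ is the rank of the subgroup $\mathbb Z T$ of $\mathbb Z^n$ generated by $T$ in the affine case, and one less in the projective case; in both cases the codimension is $m-\operatorname{rank}\mathbb ZT$. $V_T$ is called simplicial if $n<m$ and, up to a change of parameters (and a renumbering of the elements of $T$), there is a positive integer $c$ such that $\mathbf t_i=c\,\mathbf e_i$ for $i=1,\dots,n$, where $\mathbf e_1,\dots,\mathbf e_n$ is the canonical basis of $\mathbb Z^n$. Thus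 for codimension $2$ one has $T=\{\mathbf a,\mathbf b,c\mathbf e_1,\dots,c\mathbf e_n\}$. A binomial is a difference of two monomials $z_1^{\alpha_1^+}\cdots z_m^{\alpha_m^+}-z_1^{\alpha_1^-}\cdots z_m^{\alpha_m^-}$. With $r=\operatorname{codim} V_T$, $V_T$ is a binomial set-theoretic complete intersection (over $K$) if there are binomials $F_1,\dots,F_r\in K[z_1,\dots,z_m]$ with $I_T=\sqrt{(F_1,\dots,F_r)}$. It is a binomial set-theoretic complete intersection in characteristic $p$ if this holds when $K$ is an algebraically closed field of characteristic $p$. *)

(* Defs.v *)
From mathcomp Require Import all_boot all_order all_fingroup all_algebra.
From mathcomp Require Export mpoly.

Set Implicit Arguments.
Unset Strict Implicit.
Unset Printing Implicit Defensive.

Import GRing.Theory.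
Local Open Scope ring_scope.

(* A family of m exponent vectors in N^n is an m.-tuple of elements of
   'X_{1..n}; T_i is the exponent vector of the monomial parametrizing z_i. *)

Definition exponent_mx (m n : nat) (T : m.-tuple 'X_{1..n}) : 'M[rat]_(m, n) :=
  \matrix_(i < m, j < n) (tnth T i j)%:R.

(* The rank of the free abelian group Z T is the dimension of its Q-span.  For
   the affine variety the codimension is m - rank; for the projective one, which
   exists when all the T_i have the same degree, it is (m - 1) - (rank - 1). *)
Definition toric_codim (m n : nat) (T : m.-tuple 'X_{1..n}) : nat :=
  (m - \rank (exponent_mx T))%N.

(* Monomial substitutions u_j = \prod_k v_k^(M j k), with rational exponents,
   turning either parametrization into the other.  Rational, possibly negative,
   entries are needed: (1,1), (1,3) goes to 2 e_1, 2 e_2 via u_1 = v_1^3 v_2^-1,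
   u_2 = v_1^-1 v_2.  The number of parameters may change, so that superfluous
   parameters (rank Z T < n) can be eliminated. *)
Definition change_of_parameters (m n n' : nat)
    (T : m.-tuple 'X_{1..n}) (T' : m.-tuple 'X_{1..n'}) : Prop :=
  (exists M : 'M[rat]_(n, n'), exponent_mx T' = exponent_mx T *m M) /\
  (exists M' : 'M[rat]_(n', n), exponent_mx T = exponent_mx T' *m M').

Definition in_simplicial_form (m n : nat) (T : m.-tuple 'X_{1..n}) : Prop :=
  (n < m)%N /\
  exists (s : 'S_m) (c : nat), (0 < c)%N /\
    forall (i : 'I_m) (j : 'I_n), i = j :> nat ->
      tnth T (s i) = (U_(j) *+ c)%MM.

Definition simplicial (m n : nat) (T : m.-tuple 'X_{1..n}) : Prop :=
  exists (n' : nat) (T' : m.-tuple 'X_{1..n'}),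
    change_of_parameters T T' /\ in_simplicial_form T'.

Definition toric_morphism (K : fieldType) (m n : nat)
    (T : m.-tuple 'X_{1..n}) (f : {mpoly K[m]}) : {mpoly K[n]} :=
  comp_mpoly [tuple 'X_[tnth T i] | i < m] f.

Definition toric_ideal (K : fieldType) (m n : nat)
    (T : m.-tuple 'X_{1..n}) (f : {mpoly K[m]}) : Prop :=
  toric_morphism T f = 0.

Definition binomial_poly (K : fieldType) (m : nat) (f : {mpoly K[m]}) : Prop :=
  exists a b : 'X_{1..m}, f = 'X_[a] - 'X_[b].

Definition in_ideal_gen (R : comNzRingType) (r : nat)
    (F : 'I_r -> R) (f : R) : Prop :=
  exists h : 'I_r -> R, f = \sum_(i < r) h i * F i.

Definition in_radical_gen (R : comNzRingType) (r : nat)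
    (F : 'I_r -> R) (f : R) : Prop :=
  exists N : nat, in_ideal_gen F (f ^+ N).

(* When T is homogeneous, the same condition, for the same ideal and the same
   number of equations, is the one for the projective variety. *)
Definition binomial_stci (K : fieldType) (m n : nat)
    (T : m.-tuple 'X_{1..n}) : Prop :=
  exists F : 'I_(toric_codim T) -> {mpoly K[m]},
    (forall i, binomial_poly (F i)) /\
    (forall f : {mpoly K[m]}, toric_ideal T f <-> in_radical_gen F f).

Definition binomial_stci_char (p : nat) (m n : nat)
    (T : m.-tuple 'X_{1..n}) : Prop :=
  forall K : closedFieldType, p \in [pchar K] -> binomial_stci K T.

(* Main.v *)
Require Import Defs.
From mathcomp Require Import all_boot all_order all_fingroup all_algebra.
From mathcomp Require Import all_solvable all_field.
From mathcomp Require Import zify ring.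

Set Implicit Arguments.
Unset Strict Implicit.
Unset Printing Implicit Defensive.

Import GRing.Theory.
Local Open Scope ring_scope.

(** Up to a change of parameters, [T] consists of [c e_1, ..., c e_k] and two
    further vectors [a] and [b]; call the corresponding variables
    [x_1, ..., x_k], [y] and [z].  Both the toric ideal and the codimension
    depend only on the linear relations between the elements of [T], so
    everything can be read off from the pairs [(s, t)] with [s a + t b = 0]
    modulo [c].  Let [d] and [e] be the orders of [a] and [b] modulo [c], and
    let [l] be the least positive [t] such that [t b] is modulo [c] a multiple
    of [a]; thus [l] divides [e].

    - If [q] is a power of the characteristic and
      [q l b = sigma a + c rho] with [sigma] and [rho] nonnegative, then
      [y^d - x^mu] (where [d a = c mu]) and [z^(q l) - x^rho y^sigma] have
      radical [I_T] ([stci_of_z_relation]).  Indeed, the first binomial reduces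
      a relation between monomials with equal exponents of [z], and the second
      one the [q]-th power of an arbitrary relation; by additivity of [f^q] this
      is enough.
    - If the support of [a] is contained in that of [b], such a relation exists
      for every [p], because [q l b] eventually dominates [(c - 1) a]
      ([stci_of_sub_support]).  By symmetry this also settles the case where the
      support of [b] is contained in that of [a].
    - If neither support contains the other, a relation with [sigma = 0] exists
      when [e / l] is a power of [p].  Conversely, the points whose only nonzero
      coordinate is [y] or [z] lie outside [V_T], which forces one of the two
      binomials to be free of [z] and the other one to be free of [y].  Then
      every point [x = 1], [y = 1], [z = w] with [w^e = 1] is a common zero,
      hence in [V_T], which gives [w^l = 1]; over an algebraically closed field
      of characteristic [p] this says that [e / l] is a power of [p]
      ([pnat_of_stci]).

    So all primes work when one support contains the other.  Otherwise all
    primes work if [e / l] is 1, only [p] if it is a nontrivial power of [p],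
    and no prime if it has two distinct prime factors. *)

(** * Ideals, radicals and congruences between monomials *)

Section IdealGen.

Variables (R : comNzRingType) (r : nat) (F : 'I_r -> R).

Lemma in_ideal_gen0 : in_ideal_gen F 0.
Proof. by exists (fun=> 0); rewrite big1 // => i _; rewrite mul0r. Qed.

Lemma in_ideal_genD f g :
  in_ideal_gen F f -> in_ideal_gen F g -> in_ideal_gen F (f + g).
Proof.
move=> [h ->] [k ->]; exists (fun i => h i + k i).
by rewrite -big_split; apply: eq_bigr => i _; rewrite mulrDl.
Qed.

Lemma in_ideal_genM g f : in_ideal_gen F f -> in_ideal_gen F (g * f).
Proof.
move=> [h ->]; exists (fun i => g * h i).
by rewrite mulr_sumr; apply: eq_bigr => i _; rewrite mulrA.
Qed.

Lemma in_ideal_gen_sum (I : Type) (s : seq I) (G : I -> R) :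
  (forall i, in_ideal_gen F (G i)) -> in_ideal_gen F (\sum_(i <- s) G i).
Proof.
move=> FG; elim/big_ind: _ => //; [exact: in_ideal_gen0 | exact: in_ideal_genD].
Qed.

Lemma in_ideal_gen_generator i : in_ideal_gen F (F i).
Proof.
exists (fun j => (j == i)%:R); rewrite (bigD1 i) //= eqxx mul1r big1 ?addr0 //.
by move=> j /negPf->; rewrite mul0r.
Qed.

Lemma in_radical_gen_generator i : in_radical_gen F (F i).
Proof. by exists 1; rewrite expr1; apply: in_ideal_gen_generator. Qed.

Lemma in_radical_gen_morph0 (A : idomainType) (phi : {rmorphism R -> A}) f :
  (forall i, phi (F i) = 0) -> in_radical_gen F f -> phi f = 0.
Proof.
move=> phiF [N [h /(congr1 phi)]]; rewrite rmorphXn rmorph_sum big1 => [|i _].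
  by move/eqP; rewrite expf_eq0 => /andP[_ /eqP].
by rewrite rmorphM phiF mulr0.
Qed.

End IdealGen.

Lemma expr_sum_pchar (R : comNzRingType) (q : nat) (I : Type) (s : seq I)
    (G : I -> R) :
  [pchar R].-nat q -> (\sum_(i <- s) G i) ^+ q = \sum_(i <- s) G i ^+ q.
Proof.
move=> qR; have q0 : (0 < q)%N by case/andP: qR.
elim/big_rec2: _ => [|i x y _ <-]; first by rewrite expr0n gtn_eqF.
by rewrite exprDn_pchar.
Qed.

Section MonomialCongruence.

Variables (K : fieldType) (m r : nat) (F : 'I_r -> {mpoly K[m]}).

Definition mnm_cong (u v : 'X_{1..m}) : Prop :=
  in_ideal_gen F ('X_[u] - 'X_[v]).

Lemma mnm_cong_refl u : mnm_cong u u.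
Proof. by rewrite /mnm_cong subrr; apply: in_ideal_gen0. Qed.

Lemma mnm_cong_sym u v : mnm_cong u v -> mnm_cong v u.
Proof. by move/(in_ideal_genM (-1)); rewrite mulN1r opprB. Qed.

Lemma mnm_cong_trans v u w : mnm_cong u v -> mnm_cong v w -> mnm_cong u w.
Proof. by move=> uv /(in_ideal_genD uv); rewrite addrA subrK. Qed.

Lemma mnm_congDl w u v : mnm_cong u v -> mnm_cong (w + u)%MM (w + v)%MM.
Proof. by move/(in_ideal_genM 'X_[w]); rewrite mulrBr -!mpolyXD. Qed.

Lemma mnm_congMn u v k : mnm_cong u v -> mnm_cong (u *+ k)%MM (v *+ k)%MM.
Proof.
move=> uv; elim: k => [|k IHk]; first exact: mnm_cong_refl.
rewrite !mulmS; apply: (@mnm_cong_trans (u + v *+ k)%MM).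
  exact: mnm_congDl.
by rewrite ![(_ + v *+ k)%MM]addmC; apply: mnm_congDl.
Qed.

End MonomialCongruence.

(** * The toric ideal in terms of degrees *)

Section ToricIdeal.

Variables (m n : nat) (T : m.-tuple 'X_{1..n}).

(** The exponent of the image of the monomial [X^u] in the parameters. *)
Definition toric_degree (u : 'X_{1..m}) : 'X_{1..n} :=
  (\sum_i tnth T i *+ u i)%MM.

Lemma toric_morphismX (K : fieldType) u :
  toric_morphism T ('X_[u] : {mpoly K[m]}) = 'X_[toric_degree u].
Proof.
rewrite /toric_morphism comp_mpolyX.
rewrite (big_morph (fun D => 'X_[K, D]) (@mpolyXD _ _) (@mpolyX0 _ _)).
by apply: eq_bigr => i _; rewrite tnth_mktuple mpolyXn.
Qed.

Lemma mcoeff_toric_morphism (K : fieldType) (f : {mpoly K[m]}) D :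
  (toric_morphism T f)@_D = \sum_(u <- msupp f | toric_degree u == D) f@_u.
Proof.
rewrite {1}[f]mpolyE /toric_morphism (raddf_sum (comp_mpoly _)).
rewrite (raddf_sum (mcoeff D)) [RHS]big_mkcond.
apply: eq_bigr => u _ /=.
rewrite comp_mpolyZ [_ \mPo _]toric_morphismX mcoeffZ mcoeffX.
by case: eqP; rewrite ?mulr1 ?mulr0.
Qed.

Lemma toric_ideal_binomial (K : fieldType) u v :
  toric_ideal T ('X_[u] - 'X_[v] : {mpoly K[m]}) <->
  toric_degree u = toric_degree v.
Proof.
rewrite /toric_ideal /toric_morphism comp_mpolyB -!/(toric_morphism T _).
rewrite !toric_morphismX; split=> [|->]; last by rewrite subrr.
move/eqP; rewrite subr_eq0 => /eqP/mpolyP/(_ (toric_degree u)).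
rewrite !mcoeffX eqxx; case: eqP => [-> //|_] /eqP.
by rewrite oner_eq0.
Qed.

(** Replacing each monomial of [f] by a fixed representative of its degree
    changes [f] by a combination of binomials of the toric ideal, and turns an
    [f] of that ideal into 0.  As [f |-> f^q] is additive, the [q]-th power of
    [f] is the corresponding combination of [q]-th powers of binomials, so
    only the latter have to be checked. *)
Lemma toric_ideal_sub_radical (K : fieldType) (r q : nat)
    (F : 'I_r -> {mpoly K[m]}) (f : {mpoly K[m]}) :
  [pchar K].-nat q ->
  (forall u v, toric_degree u = toric_degree v ->
     mnm_cong F (u *+ q)%MM (v *+ q)%MM) ->
  toric_ideal T f -> in_radical_gen F f.
Proof.
move=> qK Fq Tf; exists q.
have qR : [pchar {mpoly K[m]}].-nat q.
  by rewrite (eq_pnat _ (pchar_lalg _)).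
pose rep D :=
  nth 0%MM (msupp f) (find [pred v | toric_degree v == D] (msupp f)).
have repP u : u \in msupp f ->
    toric_degree (rep (toric_degree u)) = toric_degree u.
  move=> uf; apply/eqP.
  apply: (@nth_find _ _ [pred v | toric_degree v == toric_degree u]).
  by apply/hasP; exists u => //=.
have f_rep : \sum_(u <- msupp f) f@_u *: 'X_[rep (toric_degree u)] = 0.
  (* Grouping by degree, the coefficient of each representative is a
     coefficient of the image of f. *)
  pose s := undup [seq toric_degree u | u <- msupp f].
  transitivity (\sum_(D <- s) (toric_morphism T f)@_D *: 'X_[K, rep D]);
    last first.
    by rewrite Tf big1 // => D _; rewrite mcoeff0 scale0r.
  under [RHS]eq_bigr => D _.
    rewrite mcoeff_toric_morphism scaler_suml big_mkcond; over.
  rewrite exchange_big /=; apply: eq_big_seq => u uf.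
  have us : toric_degree u \in s by rewrite mem_undup map_f.
  rewrite (bigD1_seq _ us (undup_uniq _)) /= eqxx big1 ?addr0 // => D.
  by rewrite eq_sym => /negPf->.
have -> : f = \sum_(u <- msupp f) f@_u *: ('X_[u] - 'X_[rep (toric_degree u)]).
  under eq_bigr => u _ do rewrite scalerBr.
  by rewrite sumrB f_rep subr0 -mpolyE.
rewrite expr_sum_pchar // big_seq big_mkcond.
apply: in_ideal_gen_sum => u; case: ifP => [uf|_]; last exact: in_ideal_gen0.
rewrite exprZn -mul_mpolyC; apply: in_ideal_genM.
rewrite exprDn_pchar // exprNn_pchar // !mpolyXn.
by apply: Fq; rewrite repP.
Qed.

End ToricIdeal.

(** * Orders modulo [c] *)

(** The case of subgroups of the integers, seen on their nonnegative part:
    the second closure property replaces subtraction. *)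
Lemma submonoid_dvdn (P : pred nat) (c : nat) :
  (0 < c)%N -> P c ->
  (forall s t, P s -> P t -> P (s + t)%N) ->
  (forall s t, P s -> P (s + t)%N -> P t) ->
  exists2 d, (0 < d)%N & forall t, P t = (d %| t)%N.
Proof.
move=> c0 Pc PD PB.
have exP : exists t, (0 < t)%N && P t by exists c; rewrite c0.
case: (ex_minnP exP) => d /andP[d0 Pd] d_min; exists d => // t.
have Pmul k : P (k * d)%N.
  by elim: k => [|k IHk]; [apply: (PB c); rewrite ?addn0 | rewrite mulSn PD].
apply/idP/idP => [Pt|/dvdnP[k ->] //].
have Pr : P (t %% d)%N by apply: (PB (t %/ d * d)%N); rewrite // -divn_eq.
rewrite /dvdn -leqn0 leqNgt; apply/negP => r0.
by have := d_min (t %% d)%N; rewrite r0 Pr leqNgt ltn_mod d0 => /(_ isT).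
Qed.

Lemma exists_mult_order (k c : nat) (w : 'I_k -> nat) :
  (0 < c)%N ->
  exists2 d, (0 < d)%N &
    forall t, (forall j, c %| t * w j)%N <-> (d %| t)%N.
Proof.
move=> c0; pose P t := [forall j, c %| t * w j]%N.
case: (@submonoid_dvdn P c c0) => [|s t|s t|d d0 dP].
- by apply/forallP => j; apply: dvdn_mulr.
- move=> /forallP Ps /forallP Pt; apply/forallP => j.
  by rewrite mulnDl dvdn_add.
- move=> /forallP Ps /forallP Pst; apply/forallP => j.
  by have := Pst j; rewrite mulnDl dvdn_addr.
by exists d => // t; rewrite -dP; apply: (rwP forallP).
Qed.

Lemma exists_relative_order (k c : nat) (a b : 'I_k -> nat) :
  (0 < c)%N ->
  exists2 l, (0 < l)%N &
    forall t, (exists s, forall j, c %| s * a j + t * b j)%N <-> (l %| t)%N.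
Proof.
move=> c0.
pose P t := [exists s : 'I_c, [forall j, c %| s * a j + t * b j]]%N.
have PP t : reflect (exists s, forall j, c %| s * a j + t * b j)%N (P t).
  apply: (iffP existsP) => [[s /forallP Ps]|[s Ps]]; first by exists s.
  exists (Ordinal (ltn_pmod s c0)); apply/forallP => j.
  by rewrite /dvdn -modnDml modnMml modnDml; apply: Ps.
case: (@submonoid_dvdn P c c0) => [|s t|s t|l l0 lP].
- by apply/PP; exists 0%N => j; rewrite mul0n add0n dvdn_mulr.
- move=> /PP[s1 P1] /PP[s2 P2]; apply/PP; exists (s1 + s2)%N => j.
  by rewrite !mulnDl addnACA dvdn_add.
- (* c - 1 stands for - 1, which is its residue modulo c. *)
  move=> /PP[s1 P1] /PP[s2 P2]; apply/PP; exists (s2 + c.-1 * s1)%N => j.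
  rewrite -(dvdn_addr _ (dvdn_mulr (s * b j) (dvdnn c))).
  have -> : (c * (s * b j) + ((s2 + c.-1 * s1) * a j + t * b j) =
      (s2 * a j + (s + t) * b j) + c.-1 * (s1 * a j + s * b j))%N.
    by case: (c) c0 => // c' _ /=; ring.
  by rewrite dvdn_add ?dvdn_mull.
by exists l => // t; rewrite -lP; apply: (rwP (PP t)).
Qed.

(** * Roots of unity in characteristic [p] *)

Lemma closed_field_prim_root (K : closedFieldType) (e : nat) :
  (e%:R != 0 :> K) -> exists w : K, e.-primitive_root w.
Proof.
move=> eK; have e0 : (0 < e)%N by case: e eK; rewrite ?eqxx.
have [rs] := closed_field_poly_normal ('X^e - 1 : {poly K}).
rewrite lead_coefXnsubC // scale1r => Xe.
have /hasP[w _ we] : has e.-primitive_root rs; last by exists w.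
apply: has_prim_root => //.
- apply/allP => w; rewrite -root_prod_XsubC -Xe => /rootP.
  rewrite !hornerE => /eqP; rewrite subr_eq0 => /eqP we.
  by apply/unity_rootP.
- by rewrite -separable_prod_XsubC -Xe separable_Xn_sub_1.
- by rewrite -ltnS -(size_prod_XsubC rs id) -Xe size_XnsubC.
Qed.

(** A primitive root of unity whose order is the prime-to-[p] part of [e] shows
    that this part divides [l]. *)
Lemma pnat_unity_roots (K : closedFieldType) (p e l : nat) :
  p \in [pchar K] -> (0 < e)%N -> (l %| e)%N ->
  (forall w : K, w ^+ e = 1 -> w ^+ l = 1) -> p.-nat (e %/ l)%N.
Proof.
move=> pK e0 le el.
have [w we] : exists w : K, (e`_p^')%N.-primitive_root w.
  apply: closed_field_prim_root; rewrite natf_neq0_pchar.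
  by rewrite (eq_pnat _ (eq_negn (pcharf_eq pK))) part_pnat.
have : w ^+ l = 1.
  by apply: el; apply/eqP; rewrite -(prim_order_dvd we) dvdn_part.
move/eqP; rewrite -(prim_order_dvd we) => /dvdnP[h lE].
have e'0 : (0 < e`_p^')%N by apply: part_gt0.
apply: (@pnat_dvd _ e`_p); last exact: part_pnat.
apply/dvdnP; exists h; apply/eqP; rewrite -(eqn_pmul2r e'0) partnC //.
by rewrite -[(_ * _ * e`_p^')%N]mulnAC -lE mulnC divnK.
Qed.

Lemma exists_closed_field_pchar (p : nat) :
  prime p -> exists K : closedFieldType, p \in [pchar K].
Proof.
move=> p_pr; have [K [f _]] := countable_algebraic_closure 'F_p.
by exists K; rewrite (fmorph_pchar f) pchar_Fp.
Qed.

(** * Simplicial families of codimension 2 *)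

(** This is all that is needed from the simplicial form
    [c e_1, ..., c e_k, a, b]: an indexing of the variables, and the relations
    between monomials.  Stating the latter as a property of [T] itself avoids
    transporting ideals along the change of parameters, and leaves the roles of
    [y] and [z] exchangeable. *)
Record simplicial_frame (m n k : nat) (T : m.-tuple 'X_{1..n}) (c : nat)
    (x : 'I_k -> 'I_m) (y z : 'I_m) (a b : 'I_k -> nat) : Prop :=
  SimplicialFrame {
    frame_scale_gt0 : (0 < c)%N;
    frame_x_inj : injective x;
    frame_x_neq_y : forall j, x j != y;
    frame_x_neq_z : forall j, x j != z;
    frame_y_neq_z : y != z;
    frame_cover : forall i, [\/ i = y, i = z | exists j, i = x j];
    frame_degree : forall u v : 'X_{1..m},
      toric_degree T u = toric_degree T v <->
      forall j, (c * u (x j) + u y * a j + u z * b j =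
                 c * v (x j) + v y * a j + v z * b j)%N
  }.

Section Frame.

Variables (m n k : nat) (T : m.-tuple 'X_{1..n}) (c : nat).
Variables (x : 'I_k -> 'I_m) (y z : 'I_m) (a b : 'I_k -> nat).
Hypothesis fT : simplicial_frame T c x y z a b.

Lemma simplicial_frame_sym : simplicial_frame T c x z y b a.
Proof.
case: fT => c0 xI xy xz yz cov deg; split=> //; first by rewrite eq_sym.
  by move=> i; case: (cov i) => ?; [apply: Or32 | apply: Or31 | apply: Or33].
move=> u v; rewrite deg.
by split=> uv j; have := uv j; rewrite addnAC [RHS]addnAC.
Qed.

Lemma frame_mnmP (u v : 'X_{1..m}) :
  (forall j, u (x j) = v (x j)) -> u y = v y -> u z = v z -> u = v.
Proof.
move=> uvx uvy uvz; apply/mnmP => i.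
by case: (frame_cover fT i) => [->|->|[j ->]].
Qed.

(** The monomial [x^alpha y^s z^t]. *)
Definition frame_mnm (alpha : 'I_k -> nat) (s t : nat) : 'X_{1..m} :=
  [multinom if i == y then s else if i == z then t
            else (\sum_(j | x j == i) alpha j)%N | i < m].

Lemma frame_mnm_y alpha s t : frame_mnm alpha s t y = s.
Proof. by rewrite mnmE eqxx. Qed.

Lemma frame_mnm_z alpha s t : frame_mnm alpha s t z = t.
Proof. by rewrite mnmE eq_sym (negPf (frame_y_neq_z fT)) eqxx. Qed.

Lemma frame_mnm_x alpha s t j : frame_mnm alpha s t (x j) = alpha j.
Proof.
rewrite mnmE (negPf (frame_x_neq_y fT j)) (negPf (frame_x_neq_z fT j)).
by rewrite (eq_bigl _ _ (inj_eq (frame_x_inj fT)^~ j)) big_pred1_eq.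
Qed.

Definition frame_mnmE :=
  (frame_mnm_x, frame_mnm_y, frame_mnm_z, @mnmDE m, @mulmnE m).

(** ** Two binomials that define the toric variety *)

Section Sufficiency.

Variables (K : fieldType) (d l q sigma : nat) (rho : 'I_k -> nat).
Hypothesis codim2 : toric_codim T = 2.
Hypothesis dP : forall s, (forall j, c %| s * a j)%N <-> (d %| s)%N.
Hypothesis lP : forall t, (exists s, forall j, c %| s * a j + t * b j)%N ->
  (l %| t)%N.
Hypothesis q_pchar : [pchar K].-nat q.
Hypothesis q_rel : forall j, (q * l * b j = sigma * a j + c * rho j)%N.

Let mu j := (d * a j %/ c)%N.

Lemma mu_relation j : (c * mu j = d * a j)%N.
Proof. by rewrite /mu mulnC divnK //; move: j; apply/dP. Qed.

Let F (i : 'I_2) : {mpoly K[m]} :=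
  if i == 0
  then 'X_[frame_mnm (fun=> 0%N) 0 (q * l)] - 'X_[frame_mnm rho sigma 0]
  else 'X_[frame_mnm (fun=> 0%N) d 0] - 'X_[frame_mnm mu 0 0].

Lemma cong_z :
  mnm_cong F (frame_mnm (fun=> 0%N) 0 (q * l)) (frame_mnm rho sigma 0).
Proof. exact: (in_ideal_gen_generator F 0). Qed.

Lemma cong_y : mnm_cong F (frame_mnm (fun=> 0%N) d 0) (frame_mnm mu 0 0).
Proof. exact: (in_ideal_gen_generator F 1). Qed.

(** If the exponents of [z] agree, those of [y] differ by a multiple of [d], so
    that rewriting [y^d] into [x^mu] makes them equal; then the exponents of the
    [x_j] are equal too, since [c > 0]. *)
Lemma cong_same_z (u v : 'X_{1..m}) :
  toric_degree T u = toric_degree T v -> u z = v z -> mnm_cong F u v.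
Proof.
wlog vu : u v / (v y <= u y)%N.
  move=> wuv; case/orP: (leq_total (v y) (u y)) => [vu|uv] Tuv uvz.
    exact: wuv.
  by apply: mnm_cong_sym; apply: wuv.
move=> /(frame_degree fT) Tuv uvz.
have /dvdnP[g uyE] : (d %| u y - v y)%N.
  apply/dP => j; rewrite mulnBl.
  rewrite -(dvdn_addl (_ - _) (dvdn_mulr (u (x j)) (dvdnn c))).
  have -> : (u y * a j - v y * a j + c * u (x j) = c * v (x j))%N.
    have := Tuv j; have := leq_mul2r (a j) (v y) (u y).
    rewrite vu orbT uvz; lia.
  exact: dvdn_mulr.
have uy : (u y = v y + g * d)%N by rewrite -uyE subnKC.
pose w := frame_mnm (fun j => u (x j)) (v y) (u z).
have -> : u = (w + frame_mnm (fun=> 0%N) d 0 *+ g)%MM.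
  by apply: frame_mnmP => [j||]; rewrite !frame_mnmE ?addn0 // mulnC.
have -> : v = (w + frame_mnm mu 0 0 *+ g)%MM.
  apply: frame_mnmP => [j||]; rewrite !frame_mnmE ?addn0 //.
  apply/eqP; rewrite -(eqn_pmul2l (frame_scale_gt0 fT)); apply/eqP.
  have := Tuv j.
  rewrite uvz uy mulnDr [(c * (mu j * g))%N]mulnA mu_relation; lia.
by apply: mnm_congDl; apply: mnm_congMn; apply: cong_y.
Qed.

(** The exponents of [z] in [u] and [v] differ by a multiple of [l], hence those
    in the [q]-th powers by a multiple of [q l], and rewriting [z^(q l)] into
    [x^rho y^sigma] reduces to the previous case. *)
Lemma cong_toric (u v : 'X_{1..m}) :
  toric_degree T u = toric_degree T v -> mnm_cong F (u *+ q)%MM (v *+ q)%MM.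
Proof.
wlog vu : u v / (v z <= u z)%N.
  move=> wuv; case/orP: (leq_total (v z) (u z)) => [vu|uv] Tuv.
    exact: wuv.
  by apply: mnm_cong_sym; apply: wuv.
move=> /(frame_degree fT) Tuv.
have /dvdnP[g uzE] : (l %| u z - v z)%N.
  apply: lP; exists (u y + c.-1 * v y)%N => j.
  rewrite mulnBl -(dvdn_addl _ (dvdn_mulr (u (x j)) (dvdnn c))).
  have -> : ((u y + c.-1 * v y) * a j + (u z * b j - v z * b j) + c * u (x j) =
             c * (v (x j) + v y * a j))%N.
    have := Tuv j; have := leq_mul2r (b j) (v z) (u z); rewrite vu orbT.
    case: (c) (frame_scale_gt0 fT) => // c' _ /=; lia.
  exact: dvdn_mulr.
have uz : (u z = v z + g * l)%N by rewrite -uzE subnKC.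
pose w := frame_mnm (fun j => u (x j) * q)%N (u y * q) (v z * q).
have -> : (u *+ q)%MM = (w + frame_mnm (fun=> 0%N) 0 (q * l) *+ g)%MM.
  by apply: frame_mnmP => [j||]; rewrite !frame_mnmE ?addn0 // uz; ring.
apply: (@mnm_cong_trans _ _ _ _ (w + frame_mnm rho sigma 0 *+ g)%MM).
  by apply: mnm_congDl; apply: mnm_congMn; apply: cong_z.
apply: cong_same_z; last by rewrite !frame_mnmE addn0.
apply/(frame_degree fT) => j; rewrite !frame_mnmE.
have := congr1 (muln q) (Tuv j); have := congr1 (muln g) (q_rel j).
rewrite uz; lia.
Qed.

(** The reductions above give one inclusion.  For the other one, both binomials
    lie in the toric ideal, which is prime as the kernel of a morphism to a
    domain, hence contains their radical. *)
Lemma stci_of_z_relation : binomial_stci K T.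
Proof.
rewrite /binomial_stci codim2; exists F; split=> [i|f].
  by rewrite /F; case: ifP => _; eexists _, _.
split; first exact: toric_ideal_sub_radical q_pchar cong_toric.
apply: (@in_radical_gen_morph0 _ _ F _
          (comp_mpoly [tuple 'X_[tnth T i] | i < m])).
move=> i; rewrite -/(toric_morphism T _) /F.
by case: ifP => _; apply/toric_ideal_binomial/(frame_degree fT) => j;
  rewrite !frame_mnmE ?q_rel ?mu_relation; lia.
Qed.

End Sufficiency.

End Frame.

(** Modulo [c], [l b = - s a], so [q l b = sigma a] for some [sigma < c].  As
    [b_j > 0] whenever [a_j > 0], a large [q] makes [q l b - sigma a]
    nonnegative. *)
Lemma stci_of_sub_support (m n k : nat) (T : m.-tuple 'X_{1..n}) (c : nat)
    (x : 'I_k -> 'I_m) (y z : 'I_m) (a b : 'I_k -> nat) (p : nat) :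
  simplicial_frame T c x y z a b -> toric_codim T = 2 ->
  (forall j, 0 < a j -> 0 < b j)%N -> prime p -> binomial_stci_char p T.
Proof.
move=> fT codim2 ab p_pr K pK; have c0 := frame_scale_gt0 fT.
have [d _ dP] := exists_mult_order a c0.
have [l l0 lP] := exists_relative_order a b c0.
have /lP[s sP] := dvdnn l.
(* Any power of p bounding all the c a_j would do. *)
pose q := (p ^ (c * \sum_j a j))%N.
have aq j : (c * a j <= q)%N.
  apply: leq_trans (ltnW (ltn_expl _ (prime_gt1 p_pr))).
  by rewrite leq_mul2l (bigD1 j) //= leq_addr orbT.
pose sigma := ((c.-1 * (q * s)) %% c)%N.
pose rho j := ((q * l * b j - sigma * a j) %/ c)%N.
apply: (@stci_of_z_relation _ _ _ _ _ _ _ _ _ _ fT K d l q sigma rho codim2 dP).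
- by move=> t /lP.
- by rewrite (eq_pnat _ (pcharf_eq pK)) pnatX pnat_id.
move=> j; have sb : (sigma * a j <= q * l * b j)%N.
  have [->|aj] := posnP (a j); first by rewrite muln0.
  apply: (@leq_trans q).
    by apply: leq_trans (aq j); rewrite leq_mul // ltnW // ltn_pmod.
  by rewrite -mulnA leq_pmulr // muln_gt0 l0 ab.
rewrite /rho [(c * _)%N]mulnC divnK; first by rewrite subnKC.
rewrite -(eqn_mod_dvd _ sb) /sigma modnMml.
rewrite -(eqn_modDl (q * s * a j)).
have -> : (q * s * a j + q * l * b j = q * (s * a j + l * b j))%N by ring.
have -> : (q * s * a j + c.-1 * (q * s) * a j = c * (q * s * a j))%N.
  by case: (c) c0 => // c' _ /=; ring.
by rewrite modnMr; have := dvdn_mull q (sP j); rewrite /dvdn => /eqP->.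
Qed.

(** ** Points off the variety, and roots of unity *)

Section Necessity.

Variables (m n k : nat) (T : m.-tuple 'X_{1..n}) (c : nat).
Variables (x : 'I_k -> 'I_m) (y z : 'I_m) (a b : 'I_k -> nat).
Variables (K : fieldType) (r : nat) (F : 'I_r -> {mpoly K[m]}).
Hypothesis fT : simplicial_frame T c x y z a b.
Hypothesis F_radical : forall f, toric_ideal T f <-> in_radical_gen F f.

(** The point whose only nonzero coordinate is [z = 1] is not in the variety, as
    [z^c - x^b] does not vanish there.  So some generator does not vanish there
    either, and one of its monomials is a power of [z].  The degree of this
    monomial vanishes at [i0] while that of [y] does not, so [y] does not occur
    in the other monomial either. *)
Lemma exists_pure_generator i0 j0 :
  (0 < a i0)%N -> b i0 = 0%N -> (0 < b j0)%N ->
  exists i, F i != 0 /\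
    forall u v, F i = 'X_[u] - 'X_[v] -> u y = 0%N /\ v y = 0%N.
Proof.
move=> ai0 bi0 bj0.
pose ez (i : 'I_m) : K := (i == z)%:R.
have ezX u : ('X_[u] : {mpoly K[m]}).@[ez] != 0 ->
    forall i, i != z -> u i = 0%N.
  rewrite mevalX => /prodf_neq0 ez_neq0 i iz; have := ez_neq0 i isT.
  by rewrite /ez (negPf iz) expr0n; case: (u i) => //= ?; rewrite eqxx.
have [i Fi] : exists i, (F i).@[ez] != 0.
  apply/existsP; apply: contraT => /existsPn F0.
  pose u := frame_mnm x y z (fun=> 0%N) 0 c.
  pose v := frame_mnm x y z b 0 0.
  have : ('X_[u] - 'X_[v] : {mpoly K[m]}).@[ez] = 0.
    apply: (@in_radical_gen_morph0 _ _ F _ (meval ez)).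
      by move=> i; apply/eqP; have := F0 i; rewrite negbK.
    apply/F_radical/toric_ideal_binomial/(frame_degree fT) => j.
    by rewrite !(frame_mnmE fT); lia.
  rewrite mevalB.
  have -> : ('X_[v] : {mpoly K[m]}).@[ez] = 0.
    apply/eqP; apply: contraT => /ezX/(_ (x j0) (frame_x_neq_z fT j0)).
    by rewrite (frame_mnm_x fT) => b0; rewrite b0 in bj0.
  rewrite mevalX big1 => [|i _]; first by move/eqP; rewrite subr0 oner_eq0.
  rewrite /ez; case: eqP => [_|/eqP iz]; first by rewrite expr1n.
  case: (frame_cover fT i) => [->|iE|[j ->]].
  - by rewrite frame_mnm_y.
  - by rewrite iE eqxx in iz.
  by rewrite (frame_mnm_x fT).
exists i; split=> [|u v FiE].
  by apply: contraNneq Fi => ->; rewrite meval0.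
have Tuv : toric_degree T u = toric_degree T v.
  apply/(@toric_ideal_binomial _ _ _ K); rewrite -FiE.
  by apply/F_radical/in_radical_gen_generator.
wlog uz : u v Tuv {FiE} / forall i, i != z -> u i = 0%N.
  move=> uvP; have [u0|/ezX uz] := eqVneq ('X_[u] : {mpoly K[m]}).@[ez] 0;
    last exact: uvP.
  have [v0|/ezX vz] := eqVneq ('X_[v] : {mpoly K[m]}).@[ez] 0.
    by rewrite FiE mevalB u0 v0 subrr eqxx in Fi.
  by have [-> ->] := uvP v u (esym Tuv) vz.
split; first by apply: uz; rewrite (frame_y_neq_z fT).
have := (frame_degree fT u v).1 Tuv i0; rewrite bi0 !muln0 !addn0.
rewrite (uz _ (frame_x_neq_z fT i0)) (uz _ (frame_y_neq_z fT)) muln0 mul0n.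
move/esym/eqP; rewrite addn_eq0 !muln_eq0 => /andP[_].
by rewrite (gtn_eqF ai0) orbF => /eqP.
Qed.

End Necessity.

(** The generators that the previous lemma gives for [z] and for [y] differ,
    hence they are all the generators.  The one without [z] vanishes whenever
    [x = y = 1]; the one without [y] is a relation between [z] and the [x_j], so
    it involves [z] only through powers of [z^e] up to a common factor. *)
Lemma pnat_of_stci (m n k : nat) (T : m.-tuple 'X_{1..n}) (c : nat)
    (x : 'I_k -> 'I_m) (y z : 'I_m) (a b : 'I_k -> nat)
    (K : closedFieldType) (p e l s : nat) (i0 j0 : 'I_k) :
  simplicial_frame T c x y z a b -> toric_codim T = 2 ->
  (0 < a i0)%N -> b i0 = 0%N -> (0 < b j0)%N -> a j0 = 0%N ->
  (0 < e)%N -> (forall t, (forall j, c %| t * b j)%N -> (e %| t)%N) ->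
  (l %| e)%N -> (forall j, c %| s * a j + l * b j)%N ->
  p \in [pchar K] -> binomial_stci K T -> p.-nat (e %/ l)%N.
Proof.
move=> fT codim2 ai0 bi0 bj0 aj0 e0 eP le sP pK.
rewrite /binomial_stci codim2 => -[F [F_binom F_rad]].
have [iz [Fz_neq0 Fz]] := exists_pure_generator fT F_rad ai0 bi0 bj0.
have [iy [_ Fy]] :=
  exists_pure_generator (simplicial_frame_sym fT) F_rad bj0 aj0 ai0.
have F_degree i u v : F i = 'X_[u] - 'X_[v] ->
    toric_degree T u = toric_degree T v.
  move=> FiE; apply/(@toric_ideal_binomial _ _ _ K); rewrite -FiE.
  by apply/F_rad/in_radical_gen_generator.
have iyz : iy != iz.
  apply/eqP => iyzE; have [u [v FE]] := F_binom iz.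
  have [uy vy] := Fz _ _ FE; rewrite iyzE in Fy; have [uz vz] := Fy _ _ FE.
  move: Fz_neq0; rewrite FE (_ : u = v) ?subrr ?eqxx //.
  apply: (frame_mnmP fT) => [j||]; rewrite ?uy ?uz //.
  have := (frame_degree fT u v).1 (F_degree _ _ _ FE) j.
  rewrite uy vy uz vz !mul0n !addn0 => /eqP.
  by rewrite eqn_pmul2l ?(frame_scale_gt0 fT) // => /eqP.
apply: (pnat_unity_roots pK e0 le) => w we.
pose pt (i : 'I_m) : K := if i == z then w else 1.
have ptX u : ('X_[u] : {mpoly K[m]}).@[pt] = w ^+ u z.
  rewrite mevalX (bigD1 z) //= /pt eqxx big1 ?mulr1 // => i /negPf->.
  by rewrite expr1n.
have w_eq u v : toric_degree T u = toric_degree T v -> u y = 0%N -> v y = 0%N ->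
    w ^+ u z = w ^+ v z.
  wlog vu : u v / (v z <= u z)%N.
    move=> wuv; case/orP: (leq_total (v z) (u z)) => [vu|uv] Tuv uy vy.
      exact: wuv.
    by symmetry; apply: wuv.
  move=> /(frame_degree fT) Tuv uy vy.
  have /dvdnP[g uzE] : (e %| u z - v z)%N.
    apply: eP => j; rewrite mulnBl.
    rewrite -(dvdn_addl (_ - _) (dvdn_mulr (u (x j)) (dvdnn c))).
    have -> : (u z * b j - v z * b j + c * u (x j) = c * v (x j))%N.
      have := Tuv j; have := leq_mul2r (b j) (v z) (u z).
      rewrite vu orbT uy vy; lia.
    exact: dvdn_mulr.
  by rewrite -(subnKC vu) uzE exprD mulnC exprM we expr1n mulr1.
have F_pt i : (F i).@[pt] = 0.
  have [u [v FE]] := F_binom i; rewrite FE mevalB !ptX.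
  have [iE|iE] : i = iz \/ i = iy.
  - have [->|iz_i] := eqVneq i iz; first by left.
    right; apply: val_inj => /=.
    move: iz_i iyz; rewrite -!val_eqE /=.
    have := ltn_ord i; have := ltn_ord iz; have := ltn_ord iy; lia.
  - rewrite iE in FE; have [uy vy] := Fz _ _ FE.
    by rewrite (w_eq u v) ?subrr //; apply: F_degree FE.
  by rewrite iE in FE; have [-> ->] := Fy _ _ FE; rewrite subrr.
pose f : {mpoly K[m]} := 'X_[frame_mnm x y z (fun=> 0%N) s l] -
  'X_[frame_mnm x y z (fun j => (s * a j + l * b j) %/ c)%N 0 0].
have : f.@[pt] = 0.
  apply: (@in_radical_gen_morph0 _ _ F _ (meval pt)) => //.
  apply/F_rad/toric_ideal_binomial/(frame_degree fT) => j.
  by rewrite !(frame_mnmE fT) [(c * (_ %/ _))%N]mulnC divnK //; lia.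
rewrite mevalB !ptX !(frame_mnm_z fT) => /eqP.
by rewrite subr_eq0 => /eqP.
Qed.

(** * The trichotomy *)

(** The degrees for [T] and for [T'] are images of each other under the matrices
    of the change of parameters, so they identify the same pairs of monomials;
    the vectors [c e_j] give [T'] full rank, whence [m = k + 2]. *)
Lemma simplicial_codim2_frame (m n : nat) (T : m.-tuple 'X_{1..n}) :
  simplicial T -> toric_codim T = 2 ->
  exists (k c : nat) (x : 'I_k -> 'I_m) (y z : 'I_m) (a b : 'I_k -> nat),
    simplicial_frame T c x y z a b.
Proof.
case=> k [T' [[[M T'M] [M' TM']] [km [s [c [c0 T's]]]]]].
have rowE (n' : nat) (S : m.-tuple 'X_{1..n'}) (u : 'X_{1..m}) :
    (\row_i (u i)%:R) *m exponent_mx S = \row_j (toric_degree S u j)%:R.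
  apply/rowP => j; rewrite !mxE mnm_sumE natr_sum; apply: eq_bigr => i _.
  by rewrite !mxE mulmnE natrM mulrC.
have degE (n' : nat) (S : m.-tuple 'X_{1..n'}) (u v : 'X_{1..m}) :
    toric_degree S u = toric_degree S v <->
    (\row_i (u i)%:R) *m exponent_mx S = (\row_i (v i)%:R) *m exponent_mx S.
  rewrite !rowE; split=> [-> //|/rowP uv]; apply/mnmP => j.
  by apply/eqP; have := uv j; rewrite !mxE => /eqP; rewrite Num.Theory.eqr_nat.
have degTT' u v : toric_degree T u = toric_degree T v <->
    toric_degree T' u = toric_degree T' v.
  by rewrite !degE; split=> uv; [rewrite T'M | rewrite TM']; rewrite !mulmxA uv.
have T'_full : row_full (exponent_mx T').
  apply/row_fullP.
  exists (\matrix_(j, i) ((i == s (widen_ord (ltnW km) j))%:R / c%:R)).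
  apply/matrixP => j j'; rewrite !mxE (bigD1 (s (widen_ord (ltnW km) j))) //=.
  rewrite big1 => [|i /negPf is_]; last by rewrite !mxE is_ !mul0r.
  rewrite !mxE eqxx (T's _ j) // mulmnE mnm1E addr0 natrM mul1r mulrCA.
  by rewrite mulVf ?mulr1 // Num.Theory.pnatr_eq0 -lt0n.
have rT : \rank (exponent_mx T) = k.
  have <- : \rank (exponent_mx T') = k by apply/eqP.
  apply/eqP; rewrite eqn_leq; apply/andP.
  by split; [rewrite TM' | rewrite T'M]; apply: mxrankM_maxl.
rewrite /toric_codim rT => mk.
have mE : m = k.+2 by lia.
subst m; have ltk1 : (k.+1 < k.+2)%N by [].
pose y := s (Ordinal km); pose z := s (Ordinal ltk1).
pose x (j : 'I_k) := s (widen_ord (ltnW km) j).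
exists k, c, x, y, z, (tnth T' y), (tnth T' z); split=> //.
- by move=> i j /perm_inj/(congr1 val) /= /val_inj.
- by move=> j; rewrite (inj_eq perm_inj) -val_eqE /= ltn_eqF.
- by move=> j; rewrite (inj_eq perm_inj) -val_eqE /= ltn_eqF // leqW.
- by rewrite (inj_eq perm_inj) -val_eqE /= ltn_eqF.
- move=> i; rewrite -(permKV s i); set i' := (s^-1)%g i.
  have [i'k|] := ltnP i' k.
    by apply: Or33; exists (Ordinal i'k); congr (s _); apply: val_inj.
  rewrite leq_eqVlt => /orP[/eqP i'k|i'k].
    by apply: Or31; congr (s _); apply: val_inj.
  apply: Or32; congr (s _); apply: val_inj => /=; have := ltn_ord i'; lia.
move=> u v; rewrite degTT'.
have degj w j : toric_degree T' w j =
    (c * w (x j) + w y * tnth T' y j + w z * tnth T' z j)%N.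
  rewrite mnm_sumE (reindex_inj (@perm_inj _ s)) /= !big_ord_recr /=.
  have -> : s (widen_ord (leqnSn k.+1) ord_max) = y.
    by congr (s _); apply: val_inj.
  have -> : s ord_max = z by congr (s _); apply: val_inj.
  rewrite !mulmnE [(w y * _)%N]mulnC [(w z * _)%N]mulnC; congr (_ + _ + _)%N.
  rewrite (bigD1 j) //= big1 ?addn0 => [|i ij].
    rewrite (_ : widen_ord _ _ = widen_ord (ltnW km) j); last exact: val_inj.
    by rewrite (T's _ j) // mulmnE mulmnE mnm1E eqxx mul1n.
  by rewrite (T's _ i) // !mulmnE mnm1E (negPf ij).
split=> [uv j|uv]; first by rewrite -!degj uv.
by apply/mnmP => j; rewrite !degj.
Qed.

Theorem corollary5 (m n : nat) (T : m.-tuple 'X_{1..n}) :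
  (1 <= n)%N -> uniq T -> simplicial T -> toric_codim T = 2 ->
  (exists! p : nat, prime p /\ binomial_stci_char p T) \/
  (forall p : nat, prime p -> binomial_stci_char p T) \/
  (forall p : nat, prime p -> ~ binomial_stci_char p T).
Proof.
move=> _ _ /simplicial_codim2_frame sT codim2.
have [k [c [x [y [z [a [b fT]]]]]]] := sT codim2.
have [/forallP ab|/forallPn[i0]] := boolP [forall j, (0 < a j) ==> (0 < b j)]%N.
  right; left=> p; apply: (stci_of_sub_support fT codim2) => j.
  exact/implyP.
rewrite negb_imply -eqn0Ngt => /andP[ai0 /eqP bi0].
have [/forallP ba|/forallPn[j0]] := boolP [forall j, (0 < b j) ==> (0 < a j)]%N.
  right; left=> p.
  apply: (stci_of_sub_support (simplicial_frame_sym fT) codim2) => j.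
  exact/implyP.
rewrite negb_imply -eqn0Ngt => /andP[bj0 /eqP aj0].
have c0 := frame_scale_gt0 fT.
have [d _ dP] := exists_mult_order a c0.
have [e e0 eP] := exists_mult_order b c0.
have [l l0 lP] := exists_relative_order a b c0.
have /lP[s sP] := dvdnn l.
have /eP eb := dvdnn e.
have le : (l %| e)%N by apply/lP; exists 0%N => j; rewrite mul0n add0n.
have stciP p : prime p -> binomial_stci_char p T <-> p.-nat (e %/ l)%N.
  move=> p_pr; split=> [Tp|p_el K pK].
    have [K pK] := exists_closed_field_pchar p_pr.
    apply: (pnat_of_stci fT codim2 ai0 bi0 bj0 aj0 e0 _ le sP pK);
      last exact: Tp.
    by move=> t /eP.
  apply: (@stci_of_z_relation _ _ _ _ _ _ _ _ _ _ fT K d l (e %/ l)%N 0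
            (fun j => e * b j %/ c)%N codim2 dP).
  - by move=> t /lP.
  - by rewrite (eq_pnat _ (pcharf_eq pK)).
  by move=> j; rewrite divnK // mul0n add0n mulnC [RHS]mulnC divnK // mulnC.
have el0 : (0 < e %/ l)%N by rewrite divn_gt0 // dvdn_leq.
have [el1|el1] := leqP (e %/ l) 1.
  right; left=> p /stciP->.
  by have -> : (e %/ l = 1)%N by lia.
have pi_el (p : nat) : p.-nat (e %/ l)%N -> pdiv (e %/ l) = p.
  by move=> p_el; apply/eqP; apply: (pnatPpi p_el); rewrite pi_pdiv.
have [Tp|nTp] := boolP ((pdiv (e %/ l)).-nat (e %/ l))%N.
  left; exists (pdiv (e %/ l)); split; first by rewrite stciP ?pdiv_prime.
  by move=> p [p_pr /(stciP p p_pr)/pi_el].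
right; right=> p p_pr /(stciP p p_pr) p_el.
by case/negP: nTp; rewrite (pi_el p).
Qed.
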